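(* Let $k$ be a field, let $H$ be a finite-dimensional Hopf algebra over $k$ with bijective antipode, let $T$ be a left $H$-torsor, and let $A$ be a right $H$-comodule algebra. If $A$ is left noetherian (respectively right noetherian), then the algebra $\widetilde{A}$ is left noetherian (respectively right noetherian).
   Context: A right (left) $H$-comodule algebra is an algebra object in the monoidal category of right (left) $H$-comodules. A left $H$-torsor is a left $H$-comodule algebra $T$, with structure map $\rho:T\to H\otimes T$ and multiplication $m:T\otimes T\to T$, such that (1) $T\cong H$ as left $H$-comodules; (2) the ring of coinvariants $\{t\in T: \rho(t)=1\otimes t\}$ equals $k$; (3) the linear map $(\mathrm{id}_H\otimes m)\circ(\rho\otimes \mathrm{id}_T):T\otimes T\to H\otimes T$ is bijective. For a right $H$-comodule algebra $A$ with structure map $\rho_A:A\to A\otimes H$, define $$\widetilde{A}=\{x\in A\otimes T : (\rho_A\otimes \mathrm{id}_T)(x)=(\mathrm{id}_A\otimes\rho)(x)\}$$ (the cotensor product $A\square_H T$). It is a subalgebra of the tensor product algebra $A\otimes T$. Equivalently, $\widetilde A=(A\otimes T)^{\mathrm{co}H}$, where $T$ is regarded as a right $H$-comodule by means of the antipode. *)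

(* Defs.v *)
Set Warnings "-notation-overridden,-ambiguous-paths,-redundant-canonical-projection,-projection-no-head-constant".
From HB Require Import structures.
From mathcomp Require Import all_boot all_order all_algebra all_field.
From mathcomp Require Import boolp classical_sets.

Set Implicit Arguments.
Unset Strict Implicit.
Unset Printing Implicit Defensive.

Import GRing.Theory.
Local Open Scope ring_scope.
Local Open Scope quotient_scope.

Definition left_ideal (R : pzRingType) (I : set R) : Prop :=
  [/\ I 0, forall x y, I x -> I y -> I (x + y) & forall a x, I x -> I (a * x)].

Definition right_ideal (R : pzRingType) (I : set R) : Prop :=
  [/\ I 0, forall x y, I x -> I y -> I (x + y) & forall a x, I x -> I (x * a)].

Definition left_noetherian (R : pzRingType) : Prop :=
  forall I : nat -> set R, (forall n, left_ideal (I n)) ->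
    (forall n, I n `<=` I n.+1)%classic ->
  exists N, forall n, (N <= n)%N -> I n = I N.

Definition right_noetherian (R : pzRingType) : Prop :=
  forall I : nat -> set R, (forall n, right_ideal (I n)) ->
    (forall n, I n `<=` I n.+1)%classic ->
  exists N, forall n, (N <= n)%N -> I n = I N.

(* The library's algType excludes the zero algebra. A pzAlgType is an
   associative unital algebra in which 1 = 0 is allowed. It is not built as a
   join of GRing.PzRing and GRing.Lmodule because these two have a common
   extension (GRing.Lalgebra) but no declared join. *)
HB.mixin Record Lmodule_isPzAlgebra (k : fieldType) A of GRing.Lmodule k A := {
  pzone : A;
  pzmul : A -> A -> A;
  pzmulA : associative pzmul;
  pzmul1x : left_id pzone pzmul;
  pzmulx1 : right_id pzone pzmul;
  pzmulDl : left_distributive pzmul +%R;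
  pzmulDr : right_distributive pzmul +%R;
  pzscalerAl : forall (c : k) (x y : A), c *: pzmul x y = pzmul (c *: x) y;
  pzscalerAr : forall (c : k) (x y : A), c *: pzmul x y = pzmul x (c *: y)
}.

#[short(type="pzAlgType")]
HB.structure Definition PzAlgebra (k : fieldType) :=
  { A of GRing.Lmodule k A & Lmodule_isPzAlgebra k A }.

#[non_forgetful_inheritance]
HB.instance Definition _ (k : fieldType) (A : pzAlgType k) :=
  GRing.Zmodule_isPzRing.Build A
    (@pzmulA k A) (@pzmul1x k A) (@pzmulx1 k A) (@pzmulDl k A) (@pzmulDr k A).

#[non_forgetful_inheritance]
HB.instance Definition _ (k : fieldType) (A : algType k) :=
  Lmodule_isPzAlgebra.Build k A (@mulrA A) (@mul1r A) (@mulr1 A)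
    (@mulrDl A) (@mulrDr A) (@scalerAl k A) (@scalerAr k A).
#[non_forgetful_inheritance]
HB.instance Definition _ (k : fieldType) (A : falgType k) :=
  Lmodule_isPzAlgebra.Build k A (@mulrA A) (@mul1r A) (@mulr1 A)
    (@mulrDl A) (@mulrDr A) (@scalerAl k A) (@scalerAr k A).

Section TensorProduct.
Variables (k : fieldType) (U V : lmodType k).

(* [:: (u1, v1); ...; (un, vn)] stands for the formal sum of the ui (x) vi;
   tensor_eq is the least congruence on these formal sums that makes (x)
   bilinear. Scalars and opposites are absorbed by the left-hand factor. *)
Inductive tensor_eq : seq (U * V) -> seq (U * V) -> Prop :=
| tensor_eq_refl s : tensor_eq s s
| tensor_eq_sym s t : tensor_eq s t -> tensor_eq t s
| tensor_eq_trans s t r : tensor_eq s t -> tensor_eq t r -> tensor_eq s r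
| tensor_eq_cat s s' t t' :
    tensor_eq s s' -> tensor_eq t t' -> tensor_eq (s ++ t) (s' ++ t')
| tensor_eq_catC s t : tensor_eq (s ++ t) (t ++ s)
| tensor_eq_zero v : tensor_eq [:: (0, v)] [::]
| tensor_eq_addl u u' v : tensor_eq [:: (u + u', v)] [:: (u, v); (u', v)]
| tensor_eq_addr u v v' : tensor_eq [:: (u, v + v')] [:: (u, v); (u, v')]
| tensor_eq_scale c u v : tensor_eq [:: (c *: u, v)] [:: (u, c *: v)].

Definition tensor_eqb (s t : seq (U * V)) : bool := `[< tensor_eq s t >].

Lemma tensor_eqb_equiv : equiv_class_of tensor_eqb.
Proof.
split=> [s|s t|t s r].
- by apply/asboolP; apply: tensor_eq_refl.
- by apply/asboolP/asboolP; apply: tensor_eq_sym.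
- by move=> /asboolP st /asboolP tr; apply/asboolP; apply: tensor_eq_trans tr.
Qed.

Canonical tensor_equiv := EquivRelPack tensor_eqb_equiv.

Definition tensor : Type := {eq_quot tensor_equiv}.
HB.instance Definition _ := Choice.on tensor.
HB.instance Definition _ := EqQuotient.on tensor.

Implicit Types (x y z : tensor) (s t : seq (U * V)).

Lemma tensor_piP s t : (\pi_tensor s = \pi_tensor t) <-> tensor_eq s t.
Proof.
by split=> [/eqP|st]; [rewrite eqmodE => /asboolP|apply/eqP; rewrite eqmodE; apply/asboolP].
Qed.

Lemma tensor_reprP s : tensor_eq (repr (\pi_tensor s)) s.
Proof. by apply/tensor_piP; rewrite reprK. Qed.

Definition tensor_scale_seq (c : k) s := [seq (c *: p.1, p.2) | p <- s].

Definition tensor_zero : tensor := \pi_tensor [::].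
Definition tensor_add x y : tensor := \pi_tensor (repr x ++ repr y).
Definition tensor_scale (c : k) x : tensor :=
  \pi_tensor (tensor_scale_seq c (repr x)).
Definition tensor_opp x : tensor := tensor_scale (-1) x.

Lemma tensor_addE s t :
  tensor_add (\pi_tensor s) (\pi_tensor t) = \pi_tensor (s ++ t).
Proof. by apply/tensor_piP/tensor_eq_cat; apply: tensor_reprP. Qed.

Lemma tensor_scale_seq_eq c s t : tensor_eq s t ->
  tensor_eq (tensor_scale_seq c s) (tensor_scale_seq c t).
Proof.
elim=> {s t} [s|s t _ h|s t r _ h1 _ h2|s s' t t' _ h1 _ h2|s t|v|u u' v|u v v'|d u v].
- exact: tensor_eq_refl.
- exact: tensor_eq_sym.
- exact: tensor_eq_trans h1 h2.
- by rewrite /tensor_scale_seq !map_cat; apply: tensor_eq_cat.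
- by rewrite /tensor_scale_seq !map_cat; apply: tensor_eq_catC.
- by rewrite /= scaler0; apply: tensor_eq_zero.
- by rewrite /= scalerDr; apply: tensor_eq_addl.
- exact: tensor_eq_addr.
- by rewrite /= scalerA mulrC -scalerA; apply: tensor_eq_scale.
Qed.

Lemma tensor_scaleE c s :
  tensor_scale c (\pi_tensor s) = \pi_tensor (tensor_scale_seq c s).
Proof. by apply/tensor_piP/tensor_scale_seq_eq/tensor_reprP. Qed.

Lemma tensor_reprE x : exists s, x = \pi_tensor s.
Proof. by exists (repr x); rewrite reprK. Qed.

Lemma tensor_addA : associative tensor_add.
Proof.
move=> x y z; case: (tensor_reprE x) (tensor_reprE y) (tensor_reprE z).
by move=> s -> [t ->] [r ->]; rewrite !tensor_addE catA.
Qed.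

Lemma tensor_addC : commutative tensor_add.
Proof.
move=> x y; case: (tensor_reprE x) (tensor_reprE y) => s -> [t ->].
by rewrite !tensor_addE; apply/tensor_piP/tensor_eq_catC.
Qed.

Lemma tensor_add0 : left_id tensor_zero tensor_add.
Proof. by move=> x; case: (tensor_reprE x) => s ->; rewrite tensor_addE. Qed.

Lemma tensor_eq_scaleD c d s : tensor_eq (tensor_scale_seq (c + d) s)
  (tensor_scale_seq c s ++ tensor_scale_seq d s).
Proof.
elim: s => [|[u v] s IH] /=; first exact: tensor_eq_refl.
apply: (@tensor_eq_trans _ ([:: (c *: u, v); (d *: u, v)] ++
   (tensor_scale_seq c s ++ tensor_scale_seq d s))).
  rewrite -cat1s scalerDl; apply: tensor_eq_cat IH; exact: tensor_eq_addl.
rewrite /= -cat1s -[X in tensor_eq _ X]cat1s; apply: tensor_eq_cat.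
  exact: tensor_eq_refl.
rewrite -cat1s -[X in tensor_eq _ (_ ++ X)]cat1s !catA; apply: tensor_eq_cat.
  exact: tensor_eq_catC.
exact: tensor_eq_refl.
Qed.

Lemma tensor_scaleDl x : {morph tensor_scale^~ x : c d / c + d >-> tensor_add c d}.
Proof.
move=> c d; case: (tensor_reprE x) => s ->.
by rewrite !tensor_scaleE tensor_addE; apply/tensor_piP/tensor_eq_scaleD.
Qed.

Lemma tensor_eq_scale0 s : tensor_eq (tensor_scale_seq 0 s) [::].
Proof.
elim: s => [|[u v] s IH] /=; first exact: tensor_eq_refl.
rewrite scale0r -cat1s -[X in tensor_eq _ X]cat0s.
by apply: tensor_eq_cat IH; apply: tensor_eq_zero.
Qed.

Lemma tensor_scale1 : left_id 1 tensor_scale.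
Proof.
move=> x; case: (tensor_reprE x) => s ->; rewrite tensor_scaleE; congr (\pi_tensor _).
by rewrite /tensor_scale_seq -[RHS]map_id; apply: eq_map => -[u v] /=; rewrite scale1r.
Qed.

Lemma tensor_addN : left_inverse tensor_zero tensor_opp tensor_add.
Proof.
move=> x; rewrite -[X in tensor_add _ X]tensor_scale1 -tensor_scaleDl addNr.
case: (tensor_reprE x) => s ->; rewrite tensor_scaleE.
exact/tensor_piP/tensor_eq_scale0.
Qed.

HB.instance Definition _ := GRing.isZmodule.Build tensor
  tensor_addA tensor_addC tensor_add0 tensor_addN.

Lemma tensor_scaleA c d x : tensor_scale c (tensor_scale d x) = tensor_scale (c * d) x.
Proof.
case: (tensor_reprE x) => s ->; rewrite !tensor_scaleE /tensor_scale_seq -map_comp.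
by congr (\pi_tensor _); apply: eq_map => -[u v] /=; rewrite scalerA.
Qed.

Lemma tensor_scaleDr : right_distributive tensor_scale +%R.
Proof.
move=> c x y; case: (tensor_reprE x) (tensor_reprE y) => s -> [t ->].
transitivity (tensor_scale c (tensor_add (\pi_tensor s) (\pi_tensor t))) => //.
transitivity (tensor_add (tensor_scale c (\pi_tensor s)) (tensor_scale c (\pi_tensor t))) => //.
by rewrite tensor_addE !tensor_scaleE tensor_addE /tensor_scale_seq map_cat.
Qed.

HB.instance Definition _ := GRing.Zmodule_isLmodule.Build k tensor
  tensor_scaleA tensor_scale1 tensor_scaleDr tensor_scaleDl.

Definition tens (u : U) (v : V) : tensor := \pi_tensor [:: (u, v)].

Lemma tens_bilinear : bilinear_for *:%R *:%R tens.
Proof.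
split=> [v|u] c a b.
- transitivity (tensor_add (tensor_scale c (tens a v)) (tens b v)) => //.
  rewrite tensor_scaleE tensor_addE; exact/tensor_piP/tensor_eq_addl.
transitivity (tensor_add (tensor_scale c (tens u a)) (tens u b)) => //.
rewrite tensor_scaleE tensor_addE; apply/tensor_piP => /=.
apply: tensor_eq_trans (tensor_eq_addr _ _ _) _.
rewrite -cat1s -[X in tensor_eq _ X]cat1s.
apply: tensor_eq_cat; last exact: tensor_eq_refl.
exact/tensor_eq_sym/tensor_eq_scale.
Qed.

HB.instance Definition _ :=
  bilinear_isBilinear.Build k U V tensor *:%R *:%R tens tens_bilinear.
HB.instance Definition _ u :=
  GRing.isLinear.Build k V tensor *:%R (tens u) (tens_bilinear.2 u).

Lemma tensor_ind (P : tensor -> Prop) :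
  P 0 -> (forall u v, P (tens u v)) -> (forall x y, P x -> P y -> P (x + y)) ->
  forall x, P x.
Proof.
move=> P0 Pt Pa x; case: (tensor_reprE x) => s ->; elim: s => [|[u v] s IH] //.
have -> : \pi_tensor ((u, v) :: s) = tens u v + (\pi_tensor s : tensor).
  by rewrite [RHS]tensor_addE.
by apply: Pa.
Qed.

Section Lift.
Variables (W : lmodType k) (f : {bilinear U -> V -> W}).

Let sumf s : W := \sum_(p <- s) f p.1 p.2.

Definition tlift x : W := \sum_(p <- repr x) f p.1 p.2.

Lemma tlift_wd s t : tensor_eq s t -> sumf s = sumf t.
Proof.
rewrite /sumf.
elim=> {s t} [s|s t _ h|s t r _ h1 _ h2|s s' t t' _ h1 _ h2|s t|v|u u' v|u v v'|d u v] //.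
- by rewrite h1.
- by rewrite !big_cat h1 h2.
- by rewrite !big_cat /= addrC.
- by rewrite big_seq1 big_nil linear0l.
- by rewrite !big_cons !big_nil !addr0 linearDl.
- by rewrite !big_cons !big_nil !addr0 linearDr.
- by rewrite !big_cons !big_nil !addr0 linearZl_LR linearZr_LR.
Qed.

Lemma tliftE s : tlift (\pi_tensor s) = sumf s.
Proof. by apply: tlift_wd; apply: tensor_reprP. Qed.

Lemma tlift_tens u v : tlift (tens u v) = f u v.
Proof. by rewrite tliftE /sumf big_seq1. Qed.

Lemma tlift_linear : linear tlift.
Proof.
move=> c x y; case: (tensor_reprE x) (tensor_reprE y) => s -> [t ->].
rewrite [_ *: _]tensor_scaleE [_ + _ in LHS]tensor_addE !tliftE /sumf big_cat /=.
congr (_ + _); rewrite big_map scaler_sumr; apply: eq_bigr => -[u v] _ /=.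
by rewrite linearZl_LR.
Qed.

HB.instance Definition _ := GRing.isLinear.Build k tensor W *:%R tlift tlift_linear.

End Lift.

Lemma tensor_linear_ext (W : lmodType k) (f g : {linear tensor -> W}) :
  (forall u v, f (tens u v) = g (tens u v)) -> f =1 g.
Proof.
move=> fg; apply: tensor_ind => [|u v|x y fx fy]; rewrite ?linear0 ?fg //.
by rewrite !linearD fx fy.
Qed.

End TensorProduct.

Arguments tens {k U V} u v.
Arguments tlift {k U V W} f x.

Notation "U ⊗ V" := (tensor U V) (at level 40, left associativity) : type_scope.
Notation "u ⊗ v" := (tens u v) (at level 40, left associativity) : ring_scope.

Section TensorMap.
Variables (k : fieldType) (U V U' V' : lmodType k).
Variables (f : {linear U -> U'}) (g : {linear V -> V'}).

Definition tmap_fun (u : U) (v : V) : (U' ⊗ V')%type := f u ⊗ g v.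

Lemma tmap_fun_bilinear : bilinear_for *:%R *:%R tmap_fun.
Proof.
split=> [v|u] c a b; rewrite /tmap_fun linearP.
- by rewrite linearDl linearZl_LR.
- by rewrite linearDr linearZr_LR.
Qed.

HB.instance Definition _ :=
  bilinear_isBilinear.Build k U V (U' ⊗ V')%type *:%R *:%R tmap_fun tmap_fun_bilinear.

Definition tmap : (U ⊗ V)%type -> (U' ⊗ V')%type := tlift tmap_fun.
HB.instance Definition _ := GRing.Linear.on tmap.

Lemma tmap_tens u v : tmap (u ⊗ v) = f u ⊗ g v.
Proof. exact: tlift_tens. Qed.

End TensorMap.

Section TensorUnit.
Variables (k : fieldType) (V : lmodType k).

Definition tunitl_fun (c : k^o) (v : V) : V := c *: v.
Definition tunitr_fun (v : V) (c : k^o) : V := c *: v.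

Lemma tunitl_fun_bilinear : bilinear_for *:%R *:%R tunitl_fun.
Proof.
split=> [v|u] c a b; rewrite /tunitl_fun.
  by rewrite /= scalerDl /= scalerA.
by rewrite /= scalerDr /= !scalerA mulrC.
Qed.

Lemma tunitr_fun_bilinear : bilinear_for *:%R *:%R tunitr_fun.
Proof.
split=> [v|u] c a b; rewrite /tunitr_fun; last first.
  by rewrite /= scalerDl /= scalerA.
by rewrite /= scalerDr /= !scalerA mulrC.
Qed.

HB.instance Definition _ :=
  bilinear_isBilinear.Build k k^o V V *:%R *:%R tunitl_fun tunitl_fun_bilinear.
HB.instance Definition _ :=
  bilinear_isBilinear.Build k V k^o V *:%R *:%R tunitr_fun tunitr_fun_bilinear.

Definition tunitl : (k^o ⊗ V)%type -> V := tlift tunitl_fun.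
HB.instance Definition _ := GRing.Linear.on tunitl.
Definition tunitr : (V ⊗ k^o)%type -> V := tlift tunitr_fun.
HB.instance Definition _ := GRing.Linear.on tunitr.

Lemma tunitl_tens (c : k^o) (v : V) : tunitl (c ⊗ v) = c *: v.
Proof. exact: tlift_tens. Qed.
Lemma tunitr_tens (c : k^o) (v : V) : tunitr (v ⊗ c) = c *: v.
Proof. exact: tlift_tens. Qed.

End TensorUnit.

Section TensorAssoc.
Variables (k : fieldType) (U V W : lmodType k).

Definition tassoc_fun2 (w : W) (u : U) (v : V) : (U ⊗ (V ⊗ W))%type := u ⊗ (v ⊗ w).

Lemma tassoc_fun2_bilinear w : bilinear_for *:%R *:%R (tassoc_fun2 w).
Proof.
split=> [v|u] c a b; rewrite /tassoc_fun2; first by rewrite linearDl linearZl_LR.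
by rewrite linearDl linearZl_LR linearDr linearZr_LR.
Qed.

HB.instance Definition _ w :=
  bilinear_isBilinear.Build k U V (U ⊗ (V ⊗ W))%type *:%R *:%R (tassoc_fun2 w)
    (tassoc_fun2_bilinear w).

Definition tassoc_fun (x : (U ⊗ V)%type) (w : W) : (U ⊗ (V ⊗ W))%type :=
  tlift (tassoc_fun2 w) x.

Lemma tassoc_fun_bilinear : bilinear_for *:%R *:%R tassoc_fun.
Proof.
split=> [w|x] c a b; rewrite /tassoc_fun; first exact: linearP.
elim/tensor_ind: x => [|u v|x y IHx IHy]; first by rewrite !linear0 /= scaler0 addr0.
- by rewrite !tlift_tens /= /tassoc_fun2 linearDr linearZr_LR linearDr linearZr_LR.
- by rewrite !linearD /= IHx IHy /= scalerDr addrACA.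
Qed.

HB.instance Definition _ :=
  bilinear_isBilinear.Build k (U ⊗ V)%type W (U ⊗ (V ⊗ W))%type *:%R *:%R tassoc_fun
    tassoc_fun_bilinear.

Definition tassoc : (U ⊗ V ⊗ W)%type -> (U ⊗ (V ⊗ W))%type := tlift tassoc_fun.
HB.instance Definition _ := GRing.Linear.on tassoc.

Lemma tassoc_tens u v w : tassoc (u ⊗ v ⊗ w) = u ⊗ (v ⊗ w).
Proof. by rewrite /tassoc tlift_tens /= /tassoc_fun tlift_tens. Qed.

End TensorAssoc.

Section TensorInterchange.
Variables (k : fieldType) (U V U' V' : lmodType k).
Local Notation dom1 := (U ⊗ V)%type.
Local Notation dom2 := (U' ⊗ V')%type.
Local Notation codom := ((U ⊗ U') ⊗ (V ⊗ V'))%type.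

Definition tinter_fun2 (y : dom2) (u : U) (v : V) : codom := tmap (tens u) (tens v) y.

Lemma tinter_fun2_bilinear y : bilinear_for *:%R *:%R (tinter_fun2 y).
Proof.
split=> [v|u] c a b; rewrite /tinter_fun2;
  elim/tensor_ind: y => [|u' v'|x y IHx IHy];
  try by rewrite !linear0 /= scaler0 addr0.
- by rewrite !tmap_tens /= linearDl linearZl_LR linearDl linearZl_LR.
- by rewrite !linearD /= IHx IHy /= scalerDr addrACA.
- by rewrite !tmap_tens /= [_ ⊗ v']linearDl linearZl_LR linearDr linearZr_LR.
- by rewrite !linearD /= IHx IHy /= scalerDr addrACA.
Qed.

HB.instance Definition _ y :=
  bilinear_isBilinear.Build k U V codom *:%R *:%R (tinter_fun2 y)
    (tinter_fun2_bilinear y).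

Definition tinter_fun (x : dom1) (y : dom2) : codom := tlift (tinter_fun2 y) x.

Lemma tinter_fun_bilinear : bilinear_for *:%R *:%R tinter_fun.
Proof.
split=> [y|x] c a b; rewrite /tinter_fun; first exact: linearP.
elim/tensor_ind: x => [|u v|x y IHx IHy]; first by rewrite !linear0 /= scaler0 addr0.
- by rewrite !tlift_tens /= /tinter_fun2 linearP.
- by rewrite !linearD /= IHx IHy /= scalerDr addrACA.
Qed.

HB.instance Definition _ :=
  bilinear_isBilinear.Build k dom1 dom2 codom *:%R *:%R tinter_fun
    tinter_fun_bilinear.

(* The middle interchange (u (x) v) (x) (u' (x) v') |-> (u (x) u') (x) (v (x) v'). *)
Definition tinter : (dom1 ⊗ dom2)%type -> codom := tlift tinter_fun.
HB.instance Definition _ := GRing.Linear.on tinter.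

Lemma tinter_tens u v u' v' : tinter ((u ⊗ v) ⊗ (u' ⊗ v')) = (u ⊗ u') ⊗ (v ⊗ v').
Proof.
by rewrite /tinter tlift_tens /= /tinter_fun tlift_tens /= /tinter_fun2 tmap_tens.
Qed.

End TensorInterchange.

Section Multiplication.
Variables (k : fieldType) (A : pzAlgType k).

Definition mulm_fun (a b : A) : A := a * b.

Lemma mulm_fun_bilinear : bilinear_for *:%R *:%R mulm_fun.
Proof.
split=> [v|u] c a b; rewrite /mulm_fun; first by rewrite mulrDl; congr (_ + _); rewrite -[LHS]pzscalerAl.
by rewrite mulrDr; congr (_ + _); rewrite -[LHS]pzscalerAr.
Qed.

HB.instance Definition _ :=
  bilinear_isBilinear.Build k A A A *:%R *:%R mulm_fun mulm_fun_bilinear.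

Definition mulm : (A ⊗ A)%type -> A := tlift mulm_fun.
HB.instance Definition _ := GRing.Linear.on mulm.

Lemma mulm_tens a b : mulm (a ⊗ b) = a * b.
Proof. exact: tlift_tens. Qed.

End Multiplication.

Section TensorAlgebra.
Variables (k : fieldType) (A B : pzAlgType k).
Local Notation AB := (A ⊗ B)%type.

Definition tensor_mul (x y : AB) : AB := tmap (@mulm k A) (@mulm k B) (tinter (x ⊗ y)).

Lemma tensor_mul_tens (a a' : A) (b b' : B) :
  tensor_mul (a ⊗ b) (a' ⊗ b') = (a * a') ⊗ (b * b').
Proof. by rewrite /tensor_mul tinter_tens tmap_tens /= !mulm_tens. Qed.

Lemma tensor_mulDl : left_distributive tensor_mul +%R.
Proof. by move=> x y z; rewrite /tensor_mul linearDl !linearD. Qed.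

Lemma tensor_mulDr : right_distributive tensor_mul +%R.
Proof. by move=> x y z; rewrite /tensor_mul linearDr !linearD. Qed.

Lemma tensor_mul0x x : tensor_mul 0 x = 0.
Proof. by rewrite /tensor_mul linear0l !linear0. Qed.

Lemma tensor_mulx0 x : tensor_mul x 0 = 0.
Proof. by rewrite /tensor_mul linear0r !linear0. Qed.

Lemma tensor_mulA : associative tensor_mul.
Proof.
move=> x y z.
elim/tensor_ind: x => [|a b|x x' IHx IHx']; first by rewrite !tensor_mul0x.
  elim/tensor_ind: y => [|a' b'|y y' IHy IHy'].
  - by rewrite tensor_mul0x tensor_mulx0 tensor_mul0x.
  - elim/tensor_ind: z => [|a'' b''|z z' IHz IHz']; first by rewrite !tensor_mulx0.
      by rewrite !tensor_mul_tens !mulrA.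
    by rewrite !tensor_mulDr IHz IHz'.
  - by rewrite tensor_mulDl !tensor_mulDr tensor_mulDl IHy IHy'.
by rewrite !tensor_mulDl IHx IHx'.
Qed.

Definition tensor_one : AB := (1 : A) ⊗ (1 : B).

Lemma tensor_mul1x : left_id tensor_one tensor_mul.
Proof.
move=> x; elim/tensor_ind: x => [|a b|x x' IHx IHx']; first by rewrite tensor_mulx0.
  by rewrite tensor_mul_tens !mul1r.
by rewrite tensor_mulDr IHx IHx'.
Qed.

Lemma tensor_mulx1 : right_id tensor_one tensor_mul.
Proof.
move=> x; elim/tensor_ind: x => [|a b|x x' IHx IHx']; first by rewrite tensor_mul0x.
  by rewrite tensor_mul_tens !mulr1.
by rewrite tensor_mulDl IHx IHx'.
Qed.

HB.instance Definition _ := GRing.Zmodule_isPzRing.Build AB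
  tensor_mulA tensor_mul1x tensor_mulx1 tensor_mulDl tensor_mulDr.

Lemma tensor_scalerAl (c : k) (x y : AB) : c *: tensor_mul x y = tensor_mul (c *: x) y.
Proof. by rewrite /tensor_mul linearZl_LR !linearZ. Qed.

Lemma tensor_scalerAr (c : k) (x y : AB) : c *: tensor_mul x y = tensor_mul x (c *: y).
Proof. by rewrite /tensor_mul linearZr_LR !linearZ. Qed.

HB.instance Definition _ := Lmodule_isPzAlgebra.Build k AB
  tensor_mulA tensor_mul1x tensor_mulx1 tensor_mulDl tensor_mulDr
  tensor_scalerAl tensor_scalerAr.

Lemma tensM (a a' : A) (b b' : B) : (a ⊗ b) * (a' ⊗ b') = (a * a') ⊗ (b * b').
Proof. exact: tensor_mul_tens. Qed.

Lemma tens11 : (1 : A) ⊗ (1 : B) = 1 :> AB.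
Proof. by []. Qed.

End TensorAlgebra.

Section TensorAlgebraMorphisms.
Variable k : fieldType.

Lemma tmap_comp (U V U' V' U'' V'' : lmodType k) (f : {linear U -> U'})
    (g : {linear V -> V'}) (f' : {linear U' -> U''}) (g' : {linear V' -> V''})
    (h : {linear U -> U''}) (l : {linear V -> V''}) :
  (forall u, f' (f u) = h u) -> (forall v, g' (g v) = l v) ->
  forall x, tmap f' g' (tmap f g x) = tmap h l x.
Proof.
move=> fh gl; elim/tensor_ind => [|u v|x y IHx IHy]; first by rewrite !linear0.
  by rewrite !tmap_tens fh gl.
by rewrite !linearD /= IHx IHy.
Qed.

Lemma tmapM (A B C D : pzAlgType k) (f : {linear A -> C}) (g : {linear B -> D}) :
  (forall a b, f (a * b) = f a * f b) -> (forall a b, g (a * b) = g a * g b) ->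
  forall x y : (A ⊗ B)%type, tmap f g (x * y) = tmap f g x * tmap f g y.
Proof.
move=> fM gM x y.
elim/tensor_ind: x => [|a b|x x' IHx IHx']; first by rewrite mul0r !linear0 mul0r.
  elim/tensor_ind: y => [|a' b'|y y' IHy IHy']; first by rewrite mulr0 !linear0 mulr0.
    by rewrite tensM !tmap_tens fM gM tensM.
  by rewrite mulrDr !linearD /= mulrDr IHy IHy'.
by rewrite mulrDl !linearD /= mulrDl IHx IHx'.
Qed.

Lemma tassocM (A B C : pzAlgType k) (x y : (A ⊗ B ⊗ C)%type) :
  tassoc (x * y) = tassoc x * tassoc y.
Proof.
elim/tensor_ind: x => [|ab c|x x' IHx IHx']; first by rewrite mul0r !linear0 mul0r.
  elim/tensor_ind: y => [|ab' c'|y y' IHy IHy']; first by rewrite mulr0 !linear0 mulr0.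
    elim/tensor_ind: ab => [|a b|x x' IHx IHx'].
    - by rewrite linear0l mul0r !linear0 mul0r.
    - elim/tensor_ind: ab' => [|a' b'|y y' IHy IHy'].
      + by rewrite linear0l mulr0 !linear0 mulr0.
      + by rewrite !tensM !tassoc_tens !tensM.
      + by rewrite linearDl /= mulrDr !linearD /= mulrDr IHy IHy'.
    - by rewrite linearDl /= mulrDl !linearD /= mulrDl IHx IHx'.
  by rewrite mulrDr !linearD /= mulrDr IHy IHy'.
by rewrite mulrDl !linearD /= mulrDl IHx IHx'.
Qed.

End TensorAlgebraMorphisms.

Record hopf_algebra (k : fieldType) (H : falgType k) := HopfAlgebra {
  comul : {lrmorphism H -> (H ⊗ H)%type};
  counit : {lrmorphism H -> k^o};
  antipode : {linear H -> H};
  comulA : forall h, tassoc (tmap comul idfun (comul h)) = tmap idfun comul (comul h);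
  counitl : forall h, tunitl (tmap counit idfun (comul h)) = h;
  counitr : forall h, tunitr (tmap idfun counit (comul h)) = h;
  antipodel : forall h, mulm (tmap antipode idfun (comul h)) = counit h *: 1;
  antipoder : forall h, mulm (tmap idfun antipode (comul h)) = counit h *: 1
}.

Section Comodules.
Variables (k : fieldType) (H : falgType k) (Hs : hopf_algebra H).

Record right_comodule (V : lmodType k) := RightComodule {
  rcoact :> {linear V -> (V ⊗ H)%type};
  rcoactA : forall v,
    tassoc (tmap rcoact idfun (rcoact v)) = tmap idfun (comul Hs) (rcoact v);
  rcoact_counit : forall v, tunitr (tmap idfun (counit Hs) (rcoact v)) = v
}.

Record left_comodule (V : lmodType k) := LeftComodule {
  lcoact :> {linear V -> (H ⊗ V)%type};
  lcoactA : forall v,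
    tassoc (tmap (comul Hs) idfun (lcoact v)) = tmap idfun lcoact (lcoact v);
  lcoact_counit : forall v, tunitl (tmap (counit Hs) idfun (lcoact v)) = v
}.

(* The codiagonal coactions on V (x) W: v (x) w |-> v0 (x) w0 (x) v1 w1,
   respectively v (x) w |-> v(-1) w(-1) (x) v0 (x) w0. *)
Definition rcoact_tensor (V W : lmodType k)
    (rV : right_comodule V) (rW : right_comodule W) (x : (V ⊗ W)%type) :
    ((V ⊗ W) ⊗ H)%type :=
  tmap idfun (@mulm k H) (tinter (tmap rV rW x)).

Definition lcoact_tensor (V W : lmodType k)
    (rV : left_comodule V) (rW : left_comodule W) (x : (V ⊗ W)%type) :
    (H ⊗ (V ⊗ W))%type :=
  tmap (@mulm k H) idfun (tinter (tmap rV rW x)).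

(* Algebra objects in the category of comodules: the multiplication and the
   unit are colinear, for the codiagonal coaction on A (x) A and the trivial
   coaction on k. *)
Record right_comodule_algebra (A : pzAlgType k) := RightComoduleAlgebra {
  rcoalg_comodule :> right_comodule A;
  rcoalg_mul : forall x : (A ⊗ A)%type,
    rcoalg_comodule (mulm x) =
      tmap (@mulm k A) idfun (rcoact_tensor rcoalg_comodule rcoalg_comodule x);
  rcoalg_unit : forall c : k, rcoalg_comodule (c *: (1 : A)) = (c *: (1 : A)) ⊗ (1 : H)
}.

Record left_comodule_algebra (A : pzAlgType k) := LeftComoduleAlgebra {
  lcoalg_comodule :> left_comodule A;
  lcoalg_mul : forall x : (A ⊗ A)%type,
    lcoalg_comodule (mulm x) =
      tmap idfun (@mulm k A) (lcoact_tensor lcoalg_comodule lcoalg_comodule x);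
  lcoalg_unit : forall c : k, lcoalg_comodule (c *: (1 : A)) = (1 : H) ⊗ (c *: (1 : A))
}.

Lemma rcoalgM (A : pzAlgType k) (rA : right_comodule_algebra A) (a b : A) :
  rA (a * b) = rA a * rA b.
Proof.
rewrite -mulm_tens rcoalg_mul /rcoact_tensor tmap_tens.
exact: (@tmap_comp _ _ _ _ _ _ _ _ _ _ _ (@mulm k A) (@mulm k H)).
Qed.

Lemma lcoalgM (A : pzAlgType k) (rA : left_comodule_algebra A) (a b : A) :
  rA (a * b) = rA a * rA b.
Proof.
rewrite -mulm_tens lcoalg_mul /lcoact_tensor tmap_tens.
exact: (@tmap_comp _ _ _ _ _ _ _ _ _ _ _ (@mulm k H) (@mulm k A)).
Qed.

Lemma rcoalg1 (A : pzAlgType k) (rA : right_comodule_algebra A) : rA 1 = 1.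
Proof. by have := rcoalg_unit rA 1; rewrite !scale1r. Qed.

Lemma lcoalg1 (A : pzAlgType k) (rA : left_comodule_algebra A) : rA 1 = 1.
Proof. by have := lcoalg_unit rA 1; rewrite !scale1r. Qed.

Record is_left_torsor (T : pzAlgType k) (rho : left_comodule_algebra T) : Prop :=
  IsLeftTorsor {
  torsor_iso : exists2 f : {linear T -> H}, bijective f &
    forall t, tmap idfun f (rho t) = comul Hs (f t);
  torsor_coinvariants : forall t : T,
    rho t = (1 : H) ⊗ t <-> exists c : k, t = c *: (1 : T);
  torsor_galois : bijective (fun x : (T ⊗ T)%type =>
    tmap idfun (@mulm k T) (tassoc (tmap rho idfun x)) : (H ⊗ T)%type)
}.

End Comodules.

Section Cotensor.
Variables (k : fieldType) (H : falgType k) (Hs : hopf_algebra H).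
Variables (A T : pzAlgType k).
Variables (rA : right_comodule_algebra Hs A) (rho : left_comodule_algebra Hs T).

Definition cotensor_pred : {pred (A ⊗ T)%type} := fun x =>
  `[< tassoc (tmap rA idfun x) = tmap idfun rho x >].

Lemma cotensorP (x : (A ⊗ T)%type) :
  reflect (tassoc (tmap rA idfun x) = tmap idfun rho x) (x \in cotensor_pred).
Proof. exact: asboolP. Qed.

Lemma cotensor_subring : subring_closed cotensor_pred.
Proof.
split=> [|x y /cotensorP Hx /cotensorP Hy|x y /cotensorP Hx /cotensorP Hy].
- apply/cotensorP; rewrite -tens11 !tmap_tens /= rcoalg1 lcoalg1 -!tens11.
  exact: tassoc_tens.
- by apply/cotensorP; rewrite !linearB /= Hx Hy.
- apply/cotensorP; rewrite tmapM ?tassocM ?Hx ?Hy ?tmapM //; first exact: lcoalgM.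
  exact: rcoalgM.
Qed.

Lemma cotensor_submod : submod_closed cotensor_pred.
Proof.
split=> [|c x y /cotensorP Hx /cotensorP Hy]; apply/cotensorP.
  by rewrite !linear0.
by rewrite !linearP /= Hx Hy.
Qed.

HB.instance Definition _ :=
  GRing.isSubringClosed.Build (A ⊗ T)%type cotensor_pred cotensor_subring.
HB.instance Definition _ :=
  GRing.isSubmodClosed.Build k (A ⊗ T)%type cotensor_pred cotensor_submod.

Record cotensor : Type := Cotensor {
  cotensor_val :> (A ⊗ T)%type;
  cotensor_valP : cotensor_val \in cotensor_pred
}.

HB.instance Definition _ := [isSub for cotensor_val].
HB.instance Definition _ := [Choice of cotensor by <:].
HB.instance Definition _ := [SubChoice_isSubZmodule of cotensor by <:].
HB.instance Definition _ := GRing.SubZmodule_isSubPzRing.Build (A ⊗ T)%type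
  cotensor_pred cotensor cotensor_subring.
HB.instance Definition _ := [SubZmodule_isSubLmodule of cotensor by <:].

Lemma cotensor_scalerAl (c : k) (x y : cotensor) : c *: (x * y) = (c *: x) * y.
Proof. by apply/val_inj/tensor_scalerAl. Qed.

Lemma cotensor_scalerAr (c : k) (x y : cotensor) : c *: (x * y) = x * (c *: y).
Proof. by apply/val_inj/tensor_scalerAr. Qed.

HB.instance Definition _ := Lmodule_isPzAlgebra.Build k cotensor
  (@mulrA cotensor) (@mul1r cotensor) (@mulr1 cotensor)
  (@mulrDl cotensor) (@mulrDr cotensor) cotensor_scalerAl cotensor_scalerAr.

Lemma cotensor_valE (x : cotensor) :
  tassoc (tmap rA idfun (x : (A ⊗ T)%type)) = tmap idfun rho (x : (A ⊗ T)%type).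
Proof. exact/cotensorP/cotensor_valP. Qed.

Lemma cotensor_valD (x y : cotensor) : cotensor_val (x + y) = cotensor_val x + cotensor_val y.
Proof. by []. Qed.

Lemma cotensor_valM (x y : cotensor) : cotensor_val (x * y) = cotensor_val x * cotensor_val y.
Proof. by []. Qed.

Lemma cotensor_val1 : cotensor_val 1 = 1.
Proof. by []. Qed.

End Cotensor.

Arguments cotensor {k H Hs A T} rA rho.

(* Main.v *)
(** A ⊗ T is left noetherian over A because T is finite-dimensional, so it is
    enough to see that A ⊗ T is a finite free right module over Ã = A □_H T: then
    I ↦ (A ⊗ T) I is an inclusion-preserving injection from left ideals of Ã to
    A-submodules of A ⊗ T.

    For any linear m : T ⊗ T -> T, if t ⊗ t' ↦ t_(-1) ⊗ m(t_0 ⊗ t') is bijective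
    onto H ⊗ T, then so is y ⊗ t' ↦ (id ⊗ m)(y ⊗ t') from Ã ⊗ T onto A ⊗ T (cotensor
    with A).  For m the multiplication this is the torsor axiom, and it makes the
    1 ⊗ t_i, for a basis (t_i) of T, a basis of the left Ã-module A ⊗ T.  For m the
    opposite multiplication it follows from the torsor axiom and the bijectivity of
    the antipode, and it makes them a basis of the right Ã-module A ⊗ T.  The right
    noetherian case is the left one for the converse rings. *)
Require Import Defs.
From HB Require Import structures.
From mathcomp Require Import all_boot all_order all_algebra all_field.
From mathcomp Require Import boolp classical_sets.

Set Implicit Arguments.
Unset Strict Implicit.
Unset Printing Implicit Defensive.

Import GRing.Theory.
Local Open Scope ring_scope.

(** * Ascending chains and descent of the noetherian property *)

(** The [c i] embed V into R^d, so the leading-coefficient argument for submodules of R^d applies: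
    at each of the d positions, the leading coefficients of the elements of [M n] form a left ideal
    [L j n], and these d chains of ideals become stationary. *)
Lemma left_noetherian_coord_chain (R : pzRingType) (V : zmodType)
    (act : R -> V -> V) d (c : 'I_d -> V -> R) (M : nat -> set V) :
  left_noetherian R ->
  (forall i v w, c i (v - w) = c i v - c i w) ->
  (forall i r v, c i (act r v) = r * c i v) ->
  (forall v, (forall i, c i v = 0) -> v = 0) ->
  (forall n v w, M n v -> M n w -> M n (v - w)) ->
  (forall n r v, M n v -> M n (act r v)) ->
  (forall n, M n 0) ->
  (forall n, M n `<=` M n.+1)%classic ->
  exists N, forall n, (N <= n)%N -> M n = M N.
Proof.
move=> noethR cB cact c_inj MB Mact M0 MS.
have Mle m n : (m <= n)%N -> (M m `<=` M n)%classic.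
  move/subnK <-; elim: (n - m)%N => [|j IH] // v /IH.
  by rewrite addSn; apply: MS.
pose L (j : 'I_d) n : set R := fun a => exists v,
  [/\ M n v, c j v = a & forall i : 'I_d, (j < i)%N -> c i v = 0].
have c0 i : c i 0 = 0 by rewrite -(subrr 0) cB subrr.
have LI j n : left_ideal (L j n).
  split=> [|a b [v [Mv <- v0]] [w [Mw <- w0]]|a b [v [Mv <- v0]]].
  - by exists 0; split.
  (* The sum v + w is written with differences, the closure that is assumed of [M n]. *)
  - exists (v - (0 - w)); split=> [||i ji].
    + by apply: (MB) => //; apply: MB.
    + by rewrite !cB c0 sub0r opprK.
    + by rewrite !cB c0 v0 // w0 // !subr0.
  - exists (act a v); rewrite cact; split=> //; first exact: Mact.
    by move=> i ji; rewrite cact v0 // mulr0.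
have LS j n : (L j n `<=` L j n.+1)%classic.
  by move=> a [v [Mv va v0]]; exists v; split=> //; apply: MS.
have /choice[N NP] j : exists N, forall n, (N <= n)%N -> L j n = L j N.
  exact: noethR.
exists (\max_j N j)%N => n leNn; apply/seteqP; split; last exact: Mle.
(* Induction on a bound [p] for the positions of the nonzero coordinates: subtracting an element of
   the smaller module with the same top coordinate lowers the bound. *)
suff red p v : M n v -> (forall i : 'I_d, (p <= i)%N -> c i v = 0) ->
    M (\max_j N j)%N v.
  by move=> v Mv; apply: (red d) => // i; rewrite leqNgt ltn_ord.
elim: p v => [|p IH] v Mv v0; first by rewrite (c_inj v) // => i; apply: v0.
have [pd|dp] := ltnP p d; last first.
  by apply: IH => // i pi; have := leq_ltn_trans (leq_trans dp pi) (ltn_ord i); rewrite ltnn.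
pose j := Ordinal pd.
have Nj : (N j <= \max_j N j)%N by apply: (leq_bigmax (F := N)).
have : L j n (c j v) by exists v; split.
rewrite NP ?(leq_trans Nj) // -(NP _ _ Nj) => -[w [Mw wv w0]].
have -> : v = (v - w) - (0 - w) by rewrite sub0r opprK subrK.
apply: (MB) => //; last by apply: MB.
apply: IH => [|i]; first by apply: MB => //; apply: Mle Mw.
rewrite cB leq_eqVlt => /predU1P[pi|pi]; last by rewrite v0 // w0 // subrr.
by rewrite (_ : i = j) ?wv ?subrr //; apply: val_inj.
Qed.

(** With C acting on B through [phi], the [e i] are a basis of the right C-module B. Uniqueness of
    coefficients lets a left ideal I of C be recovered from the sum of the e_i phi(I), and these
    sums form a chain of R-submodules of B. *)
Lemma left_noetherian_descent (R B C : pzRingType) (u : R -> B) (phi : C -> B)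
    d (c : 'I_d -> B -> R) (e : 'I_d -> B) :
  (0 < d)%N ->
  {morph phi : x y / x - y} -> {morph phi : x y / x * y} ->
  (forall i v w, c i (v - w) = c i v - c i w) ->
  (forall i r v, c i (u r * v) = r * c i v) ->
  (forall v, (forall i, c i v = 0) -> v = 0) ->
  (forall b, exists y : 'I_d -> C, b = \sum_i e i * phi (y i)) ->
  (forall y : 'I_d -> C, \sum_i e i * phi (y i) = 0 -> forall i, y i = 0) ->
  left_noetherian R -> left_noetherian C.
Proof.
move=> d_gt0 phiB phiM cB cu c_inj e_gen e_free noethR I idI IS.
have I0 n : I n 0 by case: (idI n).
have IN n x : I n x -> I n (- x).
  by case: (idI n) => _ _ IM /(IM (-1)); rewrite mulN1r.
have ID n x y : I n x -> I n y -> I n (x + y) by case: (idI n) => _ + _; apply.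
have IM n a x : I n x -> I n (a * x) by case: (idI n) => _ _; apply.
have phi0 : phi 0 = 0 by rewrite -(subrr 0) phiB subrr.
have phiN x : phi (- x) = - phi x by rewrite -sub0r phiB phi0 sub0r.
have phiD x y : phi (x + y) = phi x + phi y by rewrite -[y in LHS]opprK phiB phiN opprK.
have phi_sum (F : 'I_d -> C) : phi (\sum_i F i) = \sum_i phi (F i).
  exact: (big_morph phi phiD phi0).
pose M n : set B := fun b =>
  exists2 y : 'I_d -> C, b = \sum_i e i * phi (y i) & forall i, I n (y i).
have [|n r v|n||N NP] :=
    @left_noetherian_coord_chain R B (fun r b => u r * b) d c M noethR cB cu c_inj.
- move=> n _ _ [y -> Iy] [z -> Iz]; exists (fun i => y i - z i).
    by rewrite -sumrB; apply: eq_bigr => i _; rewrite phiB mulrBr.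
  by move=> i; apply: ID => //; apply: IN.
(* For stability under R, each [u r * e i] is expanded again in the basis; its coefficients multiply
   the [y i] from the left, so the results stay in the left ideal. *)
- move=> [y -> Iy]; have /choice[z zE] i := e_gen (u r * e i).
  exists (fun j => \sum_i z i j * y i); last first.
    by move=> j; elim/big_ind: _ => // [a b|i _]; [apply: ID|apply: IM].
  rewrite mulr_sumr.
  under eq_bigr => i _ do rewrite mulrA zE mulr_suml.
  rewrite exchange_big /=; apply: eq_bigr => j _.
  rewrite phi_sum mulr_sumr; apply: eq_bigr => i _.
  by rewrite phiM mulrA.
- by exists (fun=> 0) => //; rewrite big1 // => i _; rewrite phi0 mulr0.
- by move=> n _ [y -> Iy]; exists y => // i; apply: IS.
have Ile m n : (m <= n)%N -> (I m `<=` I n)%classic.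
  move/subnK <-; elim: (n - m)%N => [|j IH] // v /IH.
  by rewrite addSn; apply: IS.
exists N => n leNn; apply/seteqP; split; last exact: Ile.
(* One basis vector suffices: x is placed at index [i0], and freeness identifies it with the
   coefficient there, which lies in [I N]. *)
move=> x Ix; pose i0 := Ordinal d_gt0.
have : M n (e i0 * phi x).
  exists (fun i => if i == i0 then x else 0); last by move=> i; case: eqP.
  rewrite (bigD1 i0) //= ?eqxx big1 ?addr0 // => i /negPf->.
  by rewrite phi0 mulr0.
rewrite NP // => -[y yE Iy].
suff y_eq i : (if i == i0 then x else 0) - y i = 0.
  by have := y_eq i0; rewrite eqxx => /subr0_eq->.
apply: (e_free (fun i => (if i == i0 then x else 0) - y i)).
under eq_bigr do rewrite phiB mulrBr.
rewrite sumrB -yE (bigD1 i0) //= ?eqxx big1 ?addr0 ?subrr // => j /negPf->.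
by rewrite phi0 mulr0.
Qed.

(** * Functoriality and associativity of the tensor product *)

Lemma linear_inverse (k : fieldType) (U V : lmodType k) (f : {linear U -> V}) :
  bijective f -> exists g : {linear V -> U}, cancel f g /\ cancel g f.
Proof.
case=> g fK gK.
pose gL := GRing.isLinear.Build k V U *:%R g (can2_linear fK gK).
pose gl : {linear V -> U} := HB.pack g gL.
by exists gl.
Qed.

Lemma tmap_comp_fun (k : fieldType) (U V U' V' U'' V'' : lmodType k)
    (f : {linear U -> U'}) (g : {linear V -> V'})
    (f' : {linear U' -> U''}) (g' : {linear V' -> V''}) x :
  tmap f' g' (tmap f g x) = tmap (f' \o f) (g' \o g) x.
Proof. by apply: tmap_comp. Qed.

Lemma eq_tmap (k : fieldType) (U V U' V' : lmodType k)
    (f f' : {linear U -> U'}) (g g' : {linear V -> V'}) :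
  f =1 f' -> g =1 g' -> tmap f g =1 tmap f' g'.
Proof. by move=> ff' gg'; apply: tensor_linear_ext => u v /=; rewrite !tmap_tens ff' gg'. Qed.

Lemma tmap_id (k : fieldType) (U V : lmodType k) (x : (U ⊗ V)%type) :
  tmap idfun idfun x = x.
Proof.
by apply: (@tensor_linear_ext _ _ _ _ _ idfun) => u v /=; rewrite tmap_tens.
Qed.

Lemma tmap_can (k : fieldType) (U V U' V' : lmodType k)
    (f : {linear U -> U'}) (g : {linear V -> V'})
    (f' : {linear U' -> U}) (g' : {linear V' -> V}) :
  cancel f f' -> cancel g g' -> cancel (tmap f g) (tmap f' g').
Proof.
move=> fK gK x; rewrite tmap_comp_fun -[RHS]tmap_id.
by apply: eq_tmap => y /=; rewrite ?fK ?gK.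
Qed.

Lemma tassoc_nat (k : fieldType) (U V W U' V' W' : lmodType k)
    (f : {linear U -> U'}) (g : {linear V -> V'}) (h : {linear W -> W'}) x :
  tassoc (tmap (tmap f g) h x) = tmap f (tmap g h) (tassoc x).
Proof.
elim/tensor_ind: x => [|uv w|x y IHx IHy]; last by rewrite !linearD /= IHx IHy.
  by rewrite !linear0.
elim/tensor_ind: uv => [|u v|x y IHx IHy].
- by rewrite linear0l !linear0.
- by do ?rewrite !(tmap_tens, tassoc_tens) /=.
- by rewrite linearDl !linearD /= IHx IHy.
Qed.

Lemma tassoc_pentagon (k : fieldType) (U V W X : lmodType k)
    (x : (U ⊗ V ⊗ W)%type) (t : X) :
  tassoc (tassoc (x ⊗ t)) = tmap idfun (@tassoc k V W X) (tassoc (tassoc x ⊗ t)).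
Proof.
elim/tensor_ind: x => [|uv w|x y IHx IHy].
- by rewrite !(linear0, linear0l).
- elim/tensor_ind: uv => [|u v|x y IHx IHy].
  + by rewrite !(linear0, linear0l).
  + by do ?rewrite !(tmap_tens, tassoc_tens) /=.
  + by rewrite !(linearD, linearDl) /= IHx IHy.
- by rewrite !(linearD, linearDl) /= IHx IHy.
Qed.

(** * Coordinates on U ⊗ T along a basis of T and its dual basis *)

Section TensorCoordinates.
Variables (k : fieldType) (T : lmodType k) (n : nat).
Variables (b : 'I_n -> T) (l : 'I_n -> {linear T -> k^o}).
Hypothesis bE : forall t, t = \sum_i (l i t : k) *: b i.
Hypothesis lb : forall i j, l i (b j) = (i == j)%:R.

Definition tcoord (U : lmodType k) (i : 'I_n) : (U ⊗ T)%type -> U :=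
  @tunitr k U \o tmap idfun (l i).
HB.instance Definition _ U i := GRing.Linear.on (@tcoord U i).

Lemma tcoord_tens (U : lmodType k) i (u : U) t : tcoord i (u ⊗ t) = (l i t : k) *: u.
Proof. by rewrite /tcoord /= tmap_tens tunitr_tens. Qed.

Lemma tcoord_nat (U V : lmodType k) (f : {linear U -> V}) i x :
  tcoord i (tmap f idfun x) = f (tcoord i x).
Proof.
elim/tensor_ind: x => [|u t|x y IHx IHy]; last by rewrite !linearD /= IHx IHy.
  by rewrite !linear0.
by rewrite tmap_tens !tcoord_tens linearZ.
Qed.

Lemma tcoord_tassoc (U V : lmodType k) i (x : (U ⊗ V ⊗ T)%type) :
  tmap idfun (@tcoord V i) (tassoc x) = tcoord i x.
Proof.
elim/tensor_ind: x => [|uv t|x y IHx IHy]; last by rewrite !linearD /= IHx IHy.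
  by rewrite !linear0.
elim/tensor_ind: uv => [|u v|x y IHx IHy].
- by rewrite linear0l !linear0.
- by rewrite tassoc_tens tmap_tens /= !tcoord_tens linearZr_LR.
- by rewrite linearDl !linearD /= IHx IHy.
Qed.

Lemma tcoord_sum (U : lmodType k) (y : 'I_n -> U) i :
  tcoord i (\sum_j y j ⊗ b j) = y i.
Proof.
rewrite linear_sum (bigD1 i) //= tcoord_tens lb eqxx scale1r big1 ?addr0 // => j ji.
by rewrite tcoord_tens lb eq_sym (negPf ji) scale0r.
Qed.

Lemma tcoordE (U : lmodType k) (x : (U ⊗ T)%type) : x = \sum_i tcoord i x ⊗ b i.
Proof.
elim/tensor_ind: x => [|u t|x y IHx IHy].
- by rewrite big1 // => i _; rewrite linear0 linear0l.
- rewrite {1}[t]bE linear_sum; apply: eq_bigr => i _.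
  by rewrite /= tcoord_tens linearZl_LR linearZr_LR.
- rewrite {1}IHx {1}IHy -big_split; apply: eq_bigr => i _.
  by rewrite linearD linearDl.
Qed.

Lemma tcoord_eq0 (U : lmodType k) (x : (U ⊗ T)%type) :
  (forall i, tcoord i x = 0) -> x = 0.
Proof. by move=> x0; rewrite [x]tcoordE big1 // => i _; rewrite x0 linear0l. Qed.

Lemma sum_tassoc_tcoord (U V : lmodType k) (z : (U ⊗ (V ⊗ T))%type) :
  \sum_i tassoc (tmap idfun (@tcoord V i) z ⊗ b i) = z.
Proof.
elim/tensor_ind: z => [|u x|x y IHx IHy].
- by rewrite big1 // => i _; rewrite !(linear0, linear0l).
- under eq_bigr do rewrite tmap_tens tassoc_tens.
  by rewrite -linear_sum -tcoordE.
- rewrite -{2}IHx -{2}IHy -big_split; apply: eq_bigr => i _.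
  by rewrite !(linearD, linearDl).
Qed.


End TensorCoordinates.

(** * The symmetry of the tensor product *)

Section TensorSwap.
Variables (k : fieldType) (U V : lmodType k).

Definition tswap_fun (u : U) (v : V) : (V ⊗ U)%type := v ⊗ u.

Lemma tswap_fun_bilinear : bilinear_for *:%R *:%R tswap_fun.
Proof.
by split=> [v|u] c x y; rewrite /tswap_fun ?(linearDr, linearDl) ?(linearZr_LR, linearZl_LR).
Qed.

HB.instance Definition _ :=
  bilinear_isBilinear.Build k U V (V ⊗ U)%type *:%R *:%R tswap_fun tswap_fun_bilinear.

Definition tswap : (U ⊗ V)%type -> (V ⊗ U)%type := tlift tswap_fun.
HB.instance Definition _ := GRing.Linear.on tswap.

Lemma tswap_tens u v : tswap (u ⊗ v) = v ⊗ u.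
Proof. exact: tlift_tens. Qed.

End TensorSwap.

Lemma tswapK (k : fieldType) (U V : lmodType k) : cancel (@tswap k U V) (@tswap k V U).
Proof.
elim/tensor_ind=> [|u v|x y IHx IHy]; first by rewrite !linear0.
  by rewrite !tswap_tens.
by rewrite !linearD /= IHx IHy.
Qed.

(** * Galois maps T ⊗ T -> H ⊗ T *)

Section GaloisMap.
Variables (k : fieldType) (H : falgType k) (Hs : hopf_algebra H).
Variables (T : pzAlgType k) (rho : left_comodule_algebra Hs T).

(** The map of the torsor axiom when [m] is [@mulm k T]; [m] is a parameter so that the opposite
    multiplication is covered by the same arguments. *)
Definition galois_map (m : {linear (T ⊗ T)%type -> T}) : (T ⊗ T)%type -> (H ⊗ T)%type :=
  tmap idfun m \o @tassoc k H T T \o tmap rho idfun.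
HB.instance Definition _ m := GRing.Linear.on (galois_map m).

Variable m : {linear (T ⊗ T)%type -> T}.

Lemma galois_counit x : tunitl (tmap (counit Hs) idfun (galois_map m x)) = m x.
Proof.
elim/tensor_ind: x => [|t t'|x y IHx IHy]; first by rewrite !linear0.
  2: by rewrite !linearD /= IHx IHy.
rewrite /galois_map /= tmap_tens /= -[in RHS](lcoact_counit rho t).
elim/tensor_ind: (rho t) => [|h s|y z IHy IHz].
- by rewrite !(linear0, linear0l).
- by do ?rewrite !(tmap_tens, tassoc_tens) /=; rewrite !tunitl_tens linearZl_LR linearZ.
- by rewrite !(linearD, linearDl) /= IHy IHz.
Qed.

(** Both sides send t ⊗ t' to t_(-2) ⊗ t_(-1) ⊗ m(t_0 ⊗ t') by coassociativity: the Galois map is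
    colinear for [rho] on the first factor T and for the comultiplication on H. *)
Lemma galois_coact x :
  tmap idfun (galois_map m) (tassoc (tmap rho idfun x)) =
  tassoc (tmap (comul Hs) idfun (galois_map m x)).
Proof.
rewrite [in RHS]/galois_map; elim/tensor_ind: x => [|t t'|x y IHx IHy].
- by rewrite /= !linear0.
- rewrite /= !tmap_tens /=.
  (* [K] appends t' and applies [m] to the last two factors, so that [lcoactA] can be used on t
     alone. *)
  pose K w := tmap idfun (tmap idfun m) (tmap idfun (@tassoc k H T T) (tassoc (w ⊗ t'))).
  transitivity (K H (tmap idfun rho (rho t))).
    rewrite /K; elim/tensor_ind: (rho t) => [|h s|y z IHy IHz].
    - by rewrite !(linear0, linear0l).
    - by do ?rewrite !(tmap_tens, tassoc_tens) /=; rewrite /galois_map /= tmap_tens.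
    - by rewrite !(linearD, linearDl) /= IHy IHz.
  rewrite -lcoactA /K; elim/tensor_ind: (rho t) => [|h s|y z IHy IHz].
  - by rewrite !(linear0, linear0l).
  - do ?rewrite !(tmap_tens, tassoc_tens) /=; elim/tensor_ind: (comul Hs h) => [|h1 h2|y z IHy IHz].
    + by rewrite !(linear0, linear0l).
    + by do ?rewrite !(tmap_tens, tassoc_tens) /=.
    + by rewrite !(linearD, linearDl) /= IHy IHz.
  - by rewrite !(linearD, linearDl) /= IHy IHz.
- by rewrite /= !linearD /= IHx IHy.
Qed.

End GaloisMap.

(** * Generation and freeness over the cotensor product *)

Section CotensorBasis.
Variables (k : fieldType) (H : falgType k) (Hs : hopf_algebra H).
Variables (A T : pzAlgType k).
Variables (rA : right_comodule_algebra Hs A) (rho : left_comodule_algebra Hs T).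
Variables (n : nat) (b : 'I_n -> T) (l : 'I_n -> {linear T -> k^o}).
Hypothesis bE : forall t, t = \sum_i (l i t : k) *: b i.
Hypothesis lb : forall i j, l i (b j) = (i == j)%:R.
Variable m : {linear (T ⊗ T)%type -> T}.
Hypothesis galois_bij : bijective (galois_map rho m).

Lemma rcoact_tassoc (U : lmodType k) (x : (A ⊗ H)%type) (t : U) :
  tassoc (tmap rA idfun (tassoc (x ⊗ t))) =
  tmap idfun (@tassoc k H H U) (tassoc (tassoc (tmap rA idfun x) ⊗ t)).
Proof.
rewrite -tassoc_pentagon; congr tassoc.
elim/tensor_ind: x => [|a h|x y IHx IHy].
- by rewrite !(linear0, linear0l).
- rewrite tassoc_tens !tmap_tens /=.
  elim/tensor_ind: (rA a) => [|a' h'|x y IHx IHy].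
  + by rewrite !(linear0, linear0l).
  + by rewrite !tassoc_tens.
  + by rewrite !(linearD, linearDl) /= IHx IHy.
- by rewrite !(linearD, linearDl) /= IHx IHy.
Qed.

Lemma tassoc_comul (x : (A ⊗ H)%type) (t : T) :
  tmap idfun (@tassoc k H H T \o tmap (comul Hs) idfun) (tassoc (x ⊗ t)) =
  tmap idfun (@tassoc k H H T) (tassoc (tmap idfun (comul Hs) x ⊗ t)).
Proof.
elim/tensor_ind: x => [|a h|x y IHx IHy].
- by rewrite !(linear0, linear0l).
- by do ?rewrite !(tmap_tens, tassoc_tens) /=.
- by rewrite !(linearD, linearDl) /= IHx IHy.
Qed.

(** The element a_0 ⊗ a_1 ⊗ t is pulled back along the inverse Galois map to [z] in A ⊗ (T ⊗ T); the
    [y i] are the coordinates of [z] in its last factor. *)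
Lemma cotensor_gen_tens (a : A) (t : T) : exists y : 'I_n -> cotensor rA rho,
  a ⊗ t = \sum_i tmap idfun m (tassoc (cotensor_val (y i) ⊗ b i)).
Proof.
have [g [gK Kg]] := linear_inverse galois_bij.
pose w := tassoc (rA a ⊗ t).
pose z := tmap (@idfun A) g w.
have zw : tmap idfun (galois_map rho m) z = w.
  by rewrite /z tmap_comp_fun -[RHS]tmap_id; apply: eq_tmap => x //=; rewrite Kg.
clearbody z.
have galois_mono : injective
    (tmap (@idfun A) (tmap (@idfun H) (galois_map rho m))).
  apply: (can_inj (g := tmap idfun (tmap idfun g))).
  by apply: tmap_can => //; apply: tmap_can.
(* This puts [z] in the cotensor product of A with T ⊗ T. It is checked after the injective Galois
   map, where it becomes coassociativity of [rA]. *)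
have z_cot : tassoc (tmap rA idfun z) =
    tmap idfun (@tassoc k H T T \o tmap rho idfun) z.
  apply: galois_mono; rewrite tmap_comp_fun.
  transitivity (tmap (@idfun A) (@tassoc k H H T \o tmap (comul Hs) idfun) w).
    rewrite tassoc_comul -rcoactA -rcoact_tassoc -/w -zw -tassoc_nat.
    congr tassoc; rewrite !tmap_comp_fun; apply: eq_tmap => x //=.
    by rewrite tmap_id.
  rewrite -zw tmap_comp_fun; apply: eq_tmap => x //=.
  by rewrite galois_coact.
(* Taking coordinates in the last factor commutes with both coactions, so the equation for [z]
   passes to its coordinates. *)
have y_cot i : tmap idfun (tcoord l i) z \in cotensor_pred rA rho.
  apply/cotensorP; rewrite !tmap_comp_fun.
  transitivity (tassoc (tmap (tmap (@idfun A) (@idfun H)) (tcoord l i) (tmap rA idfun z))).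
    congr tassoc; rewrite tmap_comp_fun; apply: eq_tmap => x //=.
    by rewrite tmap_id.
  rewrite tassoc_nat z_cot tmap_comp_fun; apply: eq_tmap => x //=.
  by rewrite tcoord_tassoc tcoord_nat.
exists (fun i => Cotensor (y_cot i)) => /=.
rewrite -linear_sum /= sum_tassoc_tcoord //.
(* Applying the counit to the H factor of [w] gives a_0 ⊗ counit(a_1) t = a ⊗ t, and after the
   Galois map it gives [m] by [galois_counit]. *)
transitivity (tmap idfun (@tunitl k T \o tmap (counit Hs) idfun) w).
  rewrite /w -[in LHS](rcoact_counit rA a).
  elim/tensor_ind: (rA a) => [|a' h|x x' IHx IHx'].
  - by rewrite !(linear0, linear0l).
  - rewrite !(tassoc_tens, tmap_tens) /= tmap_tens tunitl_tens tunitr_tens.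
    by rewrite linearZl_LR linearZr_LR.
  - by rewrite !(linearD, linearDl) /= IHx IHx'.
by rewrite -zw tmap_comp_fun; apply: eq_tmap => x //=; rewrite galois_counit.
Qed.

Lemma cotensor_gen (w : (A ⊗ T)%type) : exists y : 'I_n -> cotensor rA rho,
  w = \sum_i tmap idfun m (tassoc (cotensor_val (y i) ⊗ b i)).
Proof.
elim/tensor_ind: w => [|a t|x x' [y ->] [y' ->]]; last first.
- exists (fun i => y i + y' i); rewrite -big_split; apply: eq_bigr => i _ /=.
  by rewrite linearDl !linearD.
- exact: cotensor_gen_tens.
- by exists (fun=> 0); rewrite big1 // => i _; rewrite /= linear0l !linear0.
Qed.

(** The defining equation of the cotensor product moves the coaction from A to T. Hence the image of
    y ⊗ t under id ⊗ m determines its image under the injective id ⊗ [galois_map], which yields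
    freeness. *)
Lemma cotensor_galois (y : cotensor rA rho) (t : T) :
  tassoc (tmap rA idfun (tmap idfun m (tassoc (cotensor_val y ⊗ t)))) =
  tmap idfun (galois_map rho m) (tassoc (cotensor_val y ⊗ t)).
Proof.
pose F : (A ⊗ (H ⊗ T))%type -> (A ⊗ (H ⊗ T))%type :=
  tmap idfun (tmap idfun (m \o applyr tens t)).
transitivity (F (tassoc (tmap rA idfun (cotensor_val y)))).
  elim/tensor_ind: (cotensor_val y) => [|a s|x x' IHx IHx'].
  - by rewrite /F !(linear0, linear0l).
  - rewrite /F !(tmap_tens, tassoc_tens) /=; elim/tensor_ind: (rA a) => [|a' h|x x' IHx IHx'].
    + by rewrite !(linear0, linear0l).
    + by do ?rewrite !(tmap_tens, tassoc_tens) /=.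
    + by rewrite !(linearD, linearDl) /= IHx IHx'.
  - by rewrite !(linearD, linearDl) /= IHx IHx' /F !linearD.
rewrite cotensor_valE; elim/tensor_ind: (cotensor_val y) => [|a s|x x' IHx IHx'].
- by rewrite /F !(linear0, linear0l).
- rewrite /F !(tmap_tens, tassoc_tens) /= /galois_map /= tmap_tens /=; congr (_ ⊗ _).
  elim/tensor_ind: (rho s) => [|h s'|x x' IHx IHx'].
  + by rewrite !(linear0, linear0l).
  + by do ?rewrite !(tmap_tens, tassoc_tens) /=.
  + by rewrite !(linearD, linearDl) /= IHx IHx'.
- by rewrite !(linearD, linearDl) /= -IHx -IHx' /F !linearD.
Qed.

Lemma cotensor_free (y : 'I_n -> cotensor rA rho) :
  \sum_i tmap idfun m (tassoc (cotensor_val (y i) ⊗ b i)) = 0 -> forall i, y i = 0.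
Proof.
move=> y0 i; have [g [gK Kg]] := linear_inverse galois_bij.
apply: val_inj => /=.
(* [y i] is a coordinate of the sum of the y_j ⊗ b_j, so it is enough that this tensor vanishes. *)
rewrite -(tcoord_sum lb (fun j => cotensor_val (y j)) i) -tcoord_tassoc.
suff -> : tassoc (\sum_j cotensor_val (y j) ⊗ b j) = 0 by rewrite linear0.
apply: (can_inj (tmap_can (f := @idfun A) (f' := idfun) (fun=> erefl) gK)).
rewrite linear0 [tassoc _]linear_sum linear_sum /=.
under eq_bigr do rewrite -cotensor_galois.
by rewrite -linear_sum -linear_sum /= y0 !linear0.
Qed.

End CotensorBasis.

(** * Left and right multiplication on A ⊗ T *)

Lemma tcoordMl (k : fieldType) (A T : pzAlgType k) n (l : 'I_n -> {linear T -> k^o})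
    i (r : A) (v : (A ⊗ T)%type) :
  tcoord l i ((r ⊗ (1 : T)) * v) = r * tcoord l i v.
Proof.
elim/tensor_ind: v => [|a t|x y IHx IHy].
- by rewrite mulr0 !linear0 mulr0.
- by rewrite tensM mul1r !tcoord_tens; apply: pzscalerAr.
- by rewrite mulrDr !linearD /= IHx IHy mulrDr.
Qed.

Lemma tcoordMr (k : fieldType) (A T : pzAlgType k) n (l : 'I_n -> {linear T -> k^o})
    i (r : A) (v : (A ⊗ T)%type) :
  tcoord l i (v * (r ⊗ (1 : T))) = tcoord l i v * r.
Proof.
elim/tensor_ind: v => [|a t|x y IHx IHy].
- by rewrite mul0r !linear0 mul0r.
- by rewrite tensM mulr1 !tcoord_tens; apply: pzscalerAl.
- by rewrite mulrDl !linearD /= IHx IHy mulrDl.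
Qed.

Lemma tmap_mulmr (k : fieldType) (A T : pzAlgType k) (w : (A ⊗ T)%type) (t : T) :
  tmap idfun (@mulm k T) (tassoc (w ⊗ t)) = w * ((1 : A) ⊗ t).
Proof.
elim/tensor_ind: w => [|a s|x y IHx IHy].
- by rewrite linear0l !linear0 mul0r.
- by rewrite tassoc_tens tmap_tens /= mulm_tens tensM mulr1.
- by rewrite linearDl !linearD /= IHx IHy mulrDl.
Qed.

Lemma tmap_mulml (k : fieldType) (A T : pzAlgType k) (w : (A ⊗ T)%type) (t : T) :
  tmap idfun (@mulm k T \o @tswap k T T) (tassoc (w ⊗ t)) = ((1 : A) ⊗ t) * w.
Proof.
elim/tensor_ind: w => [|a s|x y IHx IHy].
- by rewrite linear0l !linear0 mulr0.
- by rewrite tassoc_tens tmap_tens /= tswap_tens mulm_tens tensM mul1r.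
- by rewrite linearDl !linearD /= IHx IHy mulrDr.
Qed.

(** * Extension of maps into H ⊗ T by left multiplication by H *)

Section LeftMultiplication.
Variables (k : fieldType) (H T : pzAlgType k).

(** The left H-linear extension of [g] to H ⊗ X. The source X is arbitrary because the case X = H ⊗
    T is needed for iterated coactions. *)
Definition lmul_tens (X : lmodType k) (g : {linear X -> (H ⊗ T)%type}) :
    (H ⊗ X)%type -> (H ⊗ T)%type :=
  @mulm k (H ⊗ T)%type \o tmap (applyr tens (1 : T)) g.
HB.instance Definition _ X g := GRing.Linear.on (@lmul_tens X g).

Lemma lmul_tensE (X : lmodType k) (g : {linear X -> (H ⊗ T)%type}) h x :
  lmul_tens g (h ⊗ x) = (h ⊗ (1 : T)) * g x.
Proof. by rewrite /lmul_tens /= tmap_tens mulm_tens. Qed.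

Lemma lmul_tensM (g : {linear T -> (H ⊗ T)%type}) h y :
  lmul_tens g ((h ⊗ (1 : T)) * y) = (h ⊗ (1 : T)) * lmul_tens g y.
Proof.
elim/tensor_ind: y => [|h' t|x y IHx IHy].
- by rewrite mulr0 linear0 mulr0.
- by rewrite tensM mul1r !lmul_tensE mulrA tensM mul1r.
- by rewrite mulrDr !linearD /= mulrDr IHx IHy.
Qed.

Lemma lmul_tens_tmap (X Y : lmodType k) (f : {linear H -> H}) (g : {linear X -> Y})
    (r : {linear Y -> (H ⊗ T)%type}) (s : {linear X -> (H ⊗ T)%type}) x :
  (forall x, r (g x) = s x) -> lmul_tens r (tmap f g x) = lmul_tens s (tmap f idfun x).
Proof.
move=> rgs; elim/tensor_ind: x => [|h t|x y IHx IHy].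
- by rewrite !linear0.
- by rewrite !tmap_tens !lmul_tensE rgs.
- by rewrite !linearD /= IHx IHy.
Qed.

Lemma lmul_tens_tassoc (f f' : {linear H -> H}) (x : (H ⊗ H)%type) (t : T) :
  lmul_tens (tmap f idfun) (tmap f' idfun (tassoc (x ⊗ t))) = mulm (tmap f' f x) ⊗ t.
Proof.
elim/tensor_ind: x => [|h h'|x y IHx IHy].
- by rewrite linear0l !linear0 linear0l.
- by rewrite tassoc_tens !tmap_tens lmul_tensE /= tmap_tens tensM mul1r mulm_tens.
- by rewrite linearDl !linearD /= IHx IHy linearDl.
Qed.

End LeftMultiplication.

(** * The Galois map of the opposite multiplication *)

Section OppositeGaloisMap.
Variables (k : fieldType) (H : falgType k) (Hs : hopf_algebra H).
Variables (T : pzAlgType k) (rho : left_comodule_algebra Hs T).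

Let rhoS : {linear T -> (H ⊗ T)%type} := tmap (antipode Hs) idfun \o rho.

(** By coassociativity the left side is f'(t_(-2)) f(t_(-1)) ⊗ t_0, which collapses by the
    hypothesis and the counit axiom. The two antipode axioms are the instances where one of f, f' is
    the antipode and the other the identity. *)
Lemma lmul_tens_comul (f f' : {linear H -> H}) (t : T) :
  (forall h, mulm (tmap f' f (comul Hs h)) = counit Hs h *: 1) ->
  lmul_tens (tmap f idfun) (tmap f' idfun (tmap idfun rho (rho t))) = 1 ⊗ t.
Proof.
move=> ff'; rewrite -lcoactA -[in RHS](lcoact_counit rho t).
elim/tensor_ind: (rho t) => [|h s|x y IHx IHy].
- by rewrite !linear0.
- rewrite !tmap_tens lmul_tens_tassoc ff' tunitl_tens.
  by rewrite linearZl_LR linearZr_LR.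
- by rewrite !linearD /= IHx IHy.
Qed.

Lemma lmul_tens_rhoS t : lmul_tens rhoS (rho t) = 1 ⊗ t.
Proof.
rewrite -(lmul_tens_comul t (antipoder Hs)) tmap_id.
by rewrite (@lmul_tens_tmap _ _ _ _ _ _ _ _ rhoS) ?tmap_id.
Qed.

Lemma lmul_tens_rho t : lmul_tens rho (rhoS t) = 1 ⊗ t.
Proof.
rewrite -(lmul_tens_comul t (antipodel Hs)) tmap_comp_fun.
by rewrite [RHS](@lmul_tens_tmap _ _ _ _ _ _ _ _ rho) // => x; rewrite /= tmap_id.
Qed.

(** The maps h ⊗ t ↦ h t_(-1) ⊗ t_0 and h ⊗ t ↦ h S(t_(-1)) ⊗ t_0 are mutually inverse, by left
    H-linearity and the two preceding identities. *)
Lemma lmul_tens_rho_bij : bijective (lmul_tens rho).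
Proof.
exists (lmul_tens rhoS) => x.
- elim/tensor_ind: x => [|h t|x y IHx IHy]; first by rewrite !linear0.
    by rewrite lmul_tensE lmul_tensM lmul_tens_rhoS tensM mulr1 mul1r.
  by rewrite !linearD /= IHx IHy.
- elim/tensor_ind: x => [|h t|x y IHx IHy]; first by rewrite !linear0.
    by rewrite lmul_tensE lmul_tensM lmul_tens_rho tensM mulr1 mul1r.
  by rewrite !linearD /= IHx IHy.
Qed.

(* In Sweedler notation, t'_(-1) (x) t t'_0 = S(t_(-2)) t_(-1) t'_(-1) (x) t_0 t'_0. *)
Lemma galois_map_op x :
  galois_map rho (@mulm k T \o @tswap k T T) x =
  lmul_tens rho (tmap (antipode Hs) idfun (galois_map rho (@mulm k T) (tswap x))).
Proof.
elim/tensor_ind: x => [|t' t|x y IHx IHy].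
- by rewrite !linear0.
- rewrite tswap_tens /galois_map /= !tmap_tens /= tmap_mulml tmap_mulmr.
  transitivity (lmul_tens rho (rhoS t) * rho t').
    by rewrite lmul_tens_rho.
  rewrite /rhoS /=; elim/tensor_ind: (rho t) => [|h s|x y IHx IHy].
  + by rewrite !(mul0r, linear0).
  + by rewrite tensM !tmap_tens !lmul_tensE /= mulr1 lcoalgM mulrA.
  + by rewrite !(linearD, mulrDl) /= IHx IHy.
- by rewrite !linearD /= IHx IHy.
Qed.

(** Every factor in the formula of [galois_map_op] is bijective; bijectivity of the antipode enters
    through S ⊗ id. *)
Lemma galois_map_op_bij : bijective (antipode Hs) ->
  bijective (galois_map rho (@mulm k T)) ->
  bijective (galois_map rho (@mulm k T \o @tswap k T T)).
Proof.
move=> /linear_inverse[S' [SK KS]] bij_rho.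
apply: (eq_bij (f := lmul_tens rho \o (tmap (antipode Hs) idfun \o
   (galois_map rho (@mulm k T) \o @tswap k T T)))); last first.
  by move=> x; rewrite galois_map_op.
apply: bij_comp lmul_tens_rho_bij _; apply: bij_comp.
  by exists (tmap S' idfun); apply: tmap_can.
by apply: bij_comp bij_rho _; exists (@tswap k T T); apply: tswapK.
Qed.

End OppositeGaloisMap.

(** * Transfer of the noetherian property to the cotensor product *)

Theorem proposition3p8 (k : fieldType) (H : falgType k) (Hs : hopf_algebra H)
    (antipode_bij : bijective (antipode Hs))
    (T : pzAlgType k) (rho : left_comodule_algebra Hs T)
    (torsor_T : is_left_torsor rho)
    (A : pzAlgType k) (rA : right_comodule_algebra Hs A) :
  (left_noetherian A -> left_noetherian (cotensor rA rho)) /\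
  (right_noetherian A -> right_noetherian (cotensor rA rho)).
Proof.
case: torsor_T => -[f /linear_inverse[g [fK gK]] _] _ galois_bij.
have galois_op_bij := galois_map_op_bij antipode_bij galois_bij.
(* A basis of H and its coordinate forms are carried to T along the isomorphism T ≅ H. *)
pose n := \dim {:H}; pose X := vbasis {:H}.
pose b (i : 'I_n) : T := g X`_i.
pose l (i : 'I_n) : {linear T -> k^o} := coord X i \o f.
have bE t : t = \sum_i (l i t : k) *: b i.
  rewrite -{1}(fK t) {1}(coord_vbasis (memvf (f t))) linear_sum.
  by apply: eq_bigr => i _; rewrite linearZ.
have lb i j : l i (b j) = (i == j)%:R.
  by rewrite /l /b /= gK coord_free ?(basis_free (vbasisP _)) // eq_sym.
(* H is nonzero since 1 ≠ 0 in a [falgType]; this provides the basis vector that the descent uses to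
   recover an ideal. *)
have n_gt0 : (0 < n)%N.
  rewrite lt0n dimv_eq0; apply/negP => /eqP H0.
  by have := memvf (1 : H); rewrite H0 memv0 oner_eq0.
have coordB i : {morph @tcoord k T n l A i : v w / v - w} by move=> v w; rewrite linearB.
have coord_inj := tcoord_eq0 bE (U := A).
split.
- apply: (@left_noetherian_descent A (A ⊗ T)%type (cotensor rA rho)
    (fun a => a ⊗ (1 : T)) (@cotensor_val _ _ _ _ _ rA rho) n (tcoord l (U := A))
    (fun i => (1 : A) ⊗ b i)) => //.
  + by move=> i r v; apply: tcoordMl.
  + move=> w; have [y ->] := cotensor_gen rA bE galois_op_bij w.
    by exists y; apply: eq_bigr => i _; rewrite tmap_mulml.
  + move=> y y0; apply: (cotensor_free lb galois_op_bij).
    by rewrite -[RHS]y0; apply: eq_bigr => i _; rewrite tmap_mulml.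
(* Right ideals are left ideals of the converse ring, where [e i * phi (y i)] means
   [phi (y i) * e i] in A ⊗ T. The basis now comes from the ordinary Galois map, and the coordinates
   are used as right A-linear maps. *)
- move=> noethA.
  apply: (@left_noetherian_descent A^c (A ⊗ T)%type^c (cotensor rA rho)^c
    (fun a => a ⊗ (1 : T)) (@cotensor_val _ _ _ _ _ rA rho) n (tcoord l (U := A))
    (fun i => (1 : A) ⊗ b i)) => //.
  + by move=> i r v; apply: tcoordMr.
  + move=> w; have [y ->] := cotensor_gen rA bE galois_bij w.
    by exists y; apply: eq_bigr => i _; rewrite tmap_mulmr.
  + move=> y y0; apply: (cotensor_free lb galois_bij).
    by rewrite -[RHS]y0; apply: eq_bigr => i _; rewrite tmap_mulmr.
Qed.
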